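(* Let $f\in K[[X]][y]$ be a monic polynomial, let $\preceq$ be an additive total order on $\mathbb{R}^n$ compatible with the first orthant, and let $\mathcal{A}\subset K_{\preceq}((X))$ be a subring. If $\xi$ and $\xi'$ are roots of $f$ in $K_\preceq((X^* ))$ and $f$ is irreducible as an element of $K_{\preceq}((X))[y]$, then $\Gamma^{\preceq}_{\xi,\mathcal{A}}=\Gamma^{\preceq}_{\xi',\mathcal{A}}$.
   Context: $K$ is an algebraically closed field of characteristic zero, $n\ge 1$, and $X=(x_1,\dots,x_n)$. $\preceq$ is an additive total order on $\mathbb{R}^n$ (total order compatible with the group structure) that is compatible with the first orthant, i.e. $(\mathbb{R}_{\ge 0})^n\subset(\mathbb{R}^n)_{\succeq\underline{0}}:=\{u\in\mathbb{R}^n ; \underline{0}\preceq u\}$. A cone is a set $\sigma=\{\lambda_1u_1+\dots+\lambda_su_s ; \lambda_i\in\mathbb{R}_{\ge0}\}$ with $u_1,\dots,u_s\in\mathbb{Q}^n$; it is compatible with $\preceq$ when $\sigma\subset(\mathbb{R}^n)_{\succeq\underline{0}}$. For such $\sigma$, $K_\sigma[[X]]$ is the ring of formal series $\sum_{\gamma\in\sigma\cap\mathbb{Z}^n}a_\gamma X^\gamma$, $a_\gamma\in K$. For $k\in\mathbb{Z}_{\ge1}$, $K_\sigma[[X^{1/k}]]$ is the analogous ring of series with exponents in $\sigma\cap\frac1k\mathbb{Z}^n$. Put $K_\preceq[[X]]=\bigcup_{\sigma\subset(\mathbb{R}^n)_{\succeq\underline0}}K_\sigma[[X]]$, $K_\preceq[[X^{1/k}]]=\bigcup_{\sigma\subset(\mathbb{R}^n)_{\succeq\underline0}}K_\sigma[[X^{1/k}]]$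 and $K_\preceq[[X^*]]=\bigcup_{k\ge1}K_\preceq[[X^{1/k}]]$ (unions over compatible cones). Their fields of fractions are, respectively, $K_\preceq((X))=\{\varphi ; \exists\gamma\in\mathbb{Z}^n,\ X^\gamma\varphi\in K_\preceq[[X]]\}$, $K_\preceq((X^{1/k}))=\{\varphi ; \exists\gamma\in\mathbb{Z}^n,\ X^{\gamma/k}\varphi\in K_\preceq[[X^{1/k}]]\}$ and $K_\preceq((X^* ))=\bigcup_{k\ge1}K_\preceq((X^{1/k}))$. The field $K_\preceq((X^* ))$ is algebraically closed, and $K[[X]]\subset K_\preceq[[X]]$. For $\varphi=\sum a_\gamma X^\gamma\neq0$ in $K_\preceq((X^* ))$, $Supp(\varphi)=\{\gamma ; a_\gamma\ne0\}$ and $\nu_\preceq(\varphi):=\min_\preceq Supp(\varphi)\in\mathbb{Q}^n$. For $\xi\in K_\preceq((X^* ))$ and a subring $\mathcal{A}\subset K_\preceq((X))$, $\Gamma^\preceq_{\xi,\mathcal{A}}:=\{\nu_\preceq(h(\xi)) ; h\in\mathcal{A}[y]\setminus(y-\xi)\}\subset\mathbb{Q}^n$, where $(y-\xi)$ is the ideal of $K_\preceq((X^* ))[y]$ generated by $y-\xi$ (so $h$ runs over elements of $\mathcal{A}[y]$ with $h(\xi)\ne0$). *)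

(* Defs.v *)
From HB Require Import structures.
From mathcomp Require Import all_boot all_order all_algebra finmap.
From mathcomp Require Import mathcomp_extra boolp classical_sets functions.
From mathcomp Require Import cardinality fsbigop reals.
From mathcomp Require Import ring lra.

Set Implicit Arguments.
Unset Strict Implicit.
Unset Printing Implicit Defensive.

Import Order.TTheory GRing.Theory Num.Theory.

Local Open Scope classical_set_scope.
Local Open Scope ring_scope.

(** * Additive total orders on R^n compatible with the first orthant *)

(* Only compatibility with the group structure is required: the set of
   nonnegative vectors need not be stable under multiplication by positive
   real scalars.  For such exotic orders a rational vector may be positive
   while its half-line is not a compatible cone, and the rings below can then
   fail to be fields; they are always integral domains. *)
Record additive_order (R : realType) (n : nat) := AdditiveOrder {
  ao_le :> rel 'rV[R]_n ;
  ao_anti : antisymmetric ao_le ;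
  ao_trans : transitive ao_le ;
  ao_total : total ao_le ;
  ao_leD : forall u v w, ao_le u v -> ao_le (u + w) (v + w) ;
  ao_orthant : forall u : 'rV[R]_n, (forall i, 0 <= u 0 i) -> ao_le 0 u }.

(** * Cones, lattices and series *)

Section Series.
Variables (R : realType) (n : nat).

Definition to_real (u : 'rV[rat]_n) : 'rV[R]_n := map_mx ratr u.

Definition cone (us : seq 'rV[rat]_n) : set 'rV[R]_n :=
  [set v | exists2 l : nat -> R, (forall i, 0 <= l i) &
           v = \sum_(i < size us) l i *: to_real us`_i].

Definition compatible (le : additive_order R n) (us : seq 'rV[rat]_n) : Prop :=
  cone us `<=` [set v | le 0 v].

Definition lattice (k : nat) : set 'rV[rat]_n :=
  [set u | forall j, exists z : int, u 0 j = z%:~R / k%:R].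

Variable K : fieldType.

(* A formal series with rational exponents is its family of coefficients. *)
Definition series := 'rV[rat]_n -> K.

Definition Supp (phi : series) : set 'rV[rat]_n := [set a | phi a != 0].

Definition mul_monomial (d : 'rV[rat]_n) (phi : series) : series :=
  fun a => phi (a - d).

Variable le : additive_order R n.

(* phi belongs to K_le[[X^{1/k}]]. *)
Definition is_integral_series (k : nat) (phi : series) : Prop :=
  exists2 us, compatible le us &
    Supp phi `<=` [set a | cone us (to_real a) /\ lattice k a].

(* phi belongs to K_le((X^{1/k})): X^{z/k} phi is in K_le[[X^{1/k}]]. *)
Definition is_fractional_series (k : nat) (phi : series) : Prop :=
  exists z : 'rV[int]_n,
    is_integral_series k (mul_monomial (k%:R^-1 *: map_mx intr z) phi).

(* phi belongs to the union over k of the K_le((X^{1/k})). *)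
Definition is_puiseux : {pred series} := fun phi =>
  `[< exists2 k : nat, (0 < k)%N & is_fractional_series k phi >].

End Series.

(** * Well-ordering of the supports *)

Section Dickson.

Lemma nat_subseq (f : nat -> nat) : exists g : nat -> nat,
  {homo g : i j / (i < j)%N} /\
  (forall i j, (i <= j)%N -> (f (g i) <= f (g j))%N).
Proof.
have /choice[h hP] (m : nat) : exists j, (m <= j)%N /\
    forall j', (m <= j')%N -> (f j <= f j')%N.
  have ex : exists v, `[< exists2 j, (m <= j)%N & f j = v >].
    by exists (f m); apply/asboolP; exists m.
  case: (ex_minnP ex) => v /asboolP[j mj <-] jmin; exists j; split => // j' mj'.
  by apply: jmin; apply/asboolP; exists j'.
pose g i := iter i (fun x => h x.+1) (h 0%N).
have gS i : (g i < g i.+1)%N by rewrite /g /=; case: (hP (g i).+1).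
have gmono : {homo g : i j / (i < j)%N}.
  by apply: homo_ltn => //; exact: ltn_trans.
exists g; split => // i j; rewrite leq_eqVlt => /orP[/eqP->//|ij].
have lt_g : (g i < g j)%N := gmono _ _ ij.
case: i {ij} lt_g => [|i] lt_g /=; first by case: (hP 0%N) => _; apply.
case: (hP (g i).+1) => le1 /(_ (g j)); apply.
by apply: leq_trans (ltnW lt_g).
Qed.

Lemma nat_subseqs (I : eqType) (f : I -> nat -> nat) (s : seq I) :
  exists g : nat -> nat, {homo g : i j / (i < j)%N} /\
  (forall x, x \in s ->
     forall i j, (i <= j)%N -> (f x (g i) <= f x (g j))%N).
Proof.
elim: s => [|x s [g [ginc gP]]]; first by exists id; split.
have [h [hinc hP]] := nat_subseq (f x \o g).
exists (g \o h); split; first by move=> i j ij; apply/ginc/hinc.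
move=> y; rewrite inE => /orP[/eqP-> i j ij|ys i j ij]; first exact: hP.
by apply: gP => //; move: ij; rewrite leq_eqVlt => /orP[/eqP->//|/hinc/ltnW].
Qed.

End Dickson.

Section Cones.
Variables (R : realType) (n : nat).
Implicit Types (us vs : seq 'rV[rat]_n) (a b u : 'rV[rat]_n) (k : nat).
Local Notation toR := (@to_real R n).
Local Notation cone := (@cone R n).

Lemma to_realE a i j : toR a i j = ratr (a i j).
Proof. exact: mxE. Qed.

Lemma to_realD a b : toR (a + b) = toR a + toR b.
Proof. by rewrite /to_real map_mxD. Qed.

Lemma to_realB a b : toR (a - b) = toR a - toR b.
Proof. by rewrite /to_real map_mxB. Qed.

Lemma to_real0 : toR 0 = 0.
Proof. by rewrite /to_real map_mx0. Qed.

Lemma to_realN a : toR (- a) = - toR a.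
Proof. by rewrite /to_real map_mxN. Qed.

Lemma to_realZ (c : rat) a : toR (c *: a) = ratr c *: toR a.
Proof. by rewrite /to_real map_mxZ. Qed.

Lemma to_real_sum m (F : 'I_m -> 'rV[rat]_n) :
  toR (\sum_i F i) = \sum_i toR (F i).
Proof. exact: (big_morph _ to_realD to_real0). Qed.

Lemma to_realZn m a : toR (m%:R *: a) = m%:R *: toR a.
Proof. by rewrite to_realZ ratr_nat. Qed.

Lemma to_real_inj : injective toR.
Proof. by apply: map_mx_inj; exact: fmorph_inj. Qed.

Lemma cone0 us : cone us 0.
Proof.
by exists (fun=> 0) => //; rewrite big1// => i _; rewrite scale0r.
Qed.

Lemma coneD us (x y : 'rV[R]_n) : cone us x -> cone us y -> cone us (x + y).
Proof.
move=> [l l0 ->] [m m0 ->]; exists (fun i => l i + m i).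
  by move=> i; rewrite addr_ge0.
by rewrite -big_split; apply: eq_bigr => i _; rewrite scalerDl.
Qed.

Lemma cone_cat us vs (x y : 'rV[R]_n) :
  cone us x -> cone vs y -> cone (us ++ vs) (x + y).
Proof.
move=> [l l0 ->] [m m0 ->].
exists (fun i => if (i < size us)%N then l i else m (i - size us)%N).
  by move=> i; case: ifP.
rewrite size_cat big_split_ord/=; congr (_ + _); apply: eq_bigr => i _ /=.
  by rewrite nth_cat ltn_ord.
by rewrite nth_cat ltnNge leq_addr/= addKn.
Qed.

Lemma cone_catP us vs (x : 'rV[R]_n) : cone (us ++ vs) x ->
  exists y z, [/\ cone us y, cone vs z & x = y + z].
Proof.
move=> [l l0 ->].
exists (\sum_(i < size us) l i *: toR us`_i),
  (\sum_(i < size vs) l (size us + i)%N *: toR vs`_i); split.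
- by exists l.
- by exists (fun i => l (size us + i)%N).
- rewrite size_cat big_split_ord/=; congr (_ + _); apply: eq_bigr => i _ /=.
    by rewrite nth_cat ltn_ord.
  by rewrite nth_cat ltnNge leq_addr/= addKn.
Qed.

Definition unit_vectors : seq 'rV[rat]_n := [seq delta_mx 0 j | j <- enum 'I_n].

Lemma cone_unit_vectors (x : 'rV[R]_n) : cone unit_vectors x <-> forall j, 0 <= x 0 j.
Proof.
have toRu (j : 'I_n) : toR unit_vectors`_j = delta_mx 0 j.
  rewrite /unit_vectors (nth_map j) ?size_enum_ord// nth_ord_enum.
  by apply/rowP => i; rewrite !mxE; case: (_ && _); rewrite ?rmorph1 ?rmorph0.
have szu : size unit_vectors = n by rewrite size_map size_enum_ord.
split=> [[l l0 ->] j|x0].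
  rewrite summxE sumr_ge0// => i _.
  have i_lt : (i < n)%N by move: (ltn_ord i); rewrite [X in (_ < X)%N]szu.
  rewrite (_ : nat_of_ord i = Ordinal i_lt)// toRu !mxE.
  by rewrite mulr_ge0 ?l0 ?ler0n.
exists (fun i => if insub i is Some j then x 0 j else 0).
  by move=> i; case: insubP => //= j _ _; exact: x0.
rewrite szu {1}[x]row_sum_delta; apply: eq_bigr => i _.
by rewrite toRu valK.
Qed.

Lemma latticeP k a : (0 < k)%N ->
  lattice k a <-> forall j, k%:R * a 0 j \is a Num.int.
Proof.
move=> k0; have k_neq0 : k%:R != 0 :> rat by rewrite pnatr_eq0 -lt0n.
split=> H j.
  by have [z ->] := H j; rewrite mulrC divfK//; exact: intr_int.
by have /intrP[z zE] := H j; exists z; rewrite -zE mulrC mulKf.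
Qed.

Lemma latticeD k a b : (0 < k)%N ->
  lattice k a -> lattice k b -> lattice k (a + b).
Proof.
move=> k0 /(latticeP _ k0) ak /(latticeP _ k0) bk; apply/(latticeP _ k0) => j.
by rewrite mxE mulrDr rpredD.
Qed.

Lemma latticeN k a : (0 < k)%N -> lattice k a -> lattice k (- a).
Proof.
move=> k0 /(latticeP _ k0) ak; apply/(latticeP _ k0) => j.
by rewrite mxE mulrN rpredN.
Qed.

Lemma lattice0 k : lattice k (0 : 'rV[rat]_n).
Proof. by move=> j; exists 0; rewrite mxE mul0r. Qed.

Lemma lattice_mulr k k' a : (0 < k)%N -> (0 < k')%N ->
  lattice k a -> lattice (k * k') a.
Proof.
move=> k0 k'0 /(latticeP _ k0) ak; apply/latticeP; first by rewrite muln_gt0 k0.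
by move=> j; rewrite natrM mulrAC rpredM// natr_int.
Qed.

Lemma lattice_int k (z : 'rV[int]_n) : lattice k (k%:R^-1 *: map_mx intr z).
Proof. by move=> j; exists (z 0 j); rewrite !mxE mulrC. Qed.

Lemma common_denom us : exists2 d : nat, (0 < d)%N &
  forall i j, d%:R * (us`_i : 'rV[rat]_n) 0 j \is a Num.int.
Proof.
have one (u : 'rV[rat]_n) : exists2 d : nat, (0 < d)%N &
    forall j, d%:R * u 0 j \is a Num.int.
  exists (\prod_j `|denq (u ord0 j)|)%N.
    by rewrite prodn_gt0// => j; rewrite absz_gt0 denq_neq0.
  move=> j; rewrite (bigD1 j)//= natrM mulrAC rpredM ?natr_int//.
  have -> : (`|denq (u ord0 j)|%N)%:R = (denq (u ord0 j))%:~R :> rat.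
    by rewrite pmulrn abszE ger0_norm ?denq_ge0.
  by rewrite [_ * _]mulrC -numqE intr_int.
elim: us => [|u us [d d0 dP]].
  by exists 1%N => // i j; rewrite nth_nil mxE mulr0 rpred0.
have [e e0 eP] := one u; exists (d * e)%N; first by rewrite muln_gt0 d0.
case=> [|i] j /=; rewrite natrM; last by rewrite mulrAC rpredM// natr_int.
by rewrite -mulrA rpredM ?natr_int.
Qed.

Lemma cone_lattice_subseq us k (a : nat -> 'rV[rat]_n) : (0 < k)%N ->
  (forall m, cone us (toR (a m)) /\ lattice k (a m)) ->
  exists g : nat -> nat, {homo g : i j / (i < j)%N} /\
    (forall i j, (i <= j)%N -> cone us (toR (a (g j) - a (g i)))).
Proof.
move=> k0 aP.
have /choice[l lP] m : exists l : nat -> R, (forall i, 0 <= l i) /\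
    toR (a m) = \sum_(i < size us) l i *: toR us`_i.
  by have [[l l0 lE] _] := aP m; exists l.
have [d d0 dP] := common_denom us.
have dR0 : 0 < d%:R :> R by rewrite ltr0n.
pose q m i := Num.truncn (l m i / d%:R).
have qP m i : 0 <= l m i - (q m i * d)%:R <= d%:R.
  have /truncn_itv/andP[] : 0 <= l m i / d%:R by rewrite divr_ge0 ?(lP m).1.
  rewrite -/(q m i) ler_pdivlMr// ltr_pdivrMr// natrM -natr1 mulrDl mul1r.
  by move=> ? ?; apply/andP; split; lra.
pose r m := a m - \sum_(i < size us) (q m i * d)%:R *: us`_i.
pose B j := \sum_(i < size us) d%:R * `|(us`_i : 'rV[rat]_n) 0 j|.
have rB m j : `|r m 0 j| <= B j.
  rewrite -(ler_rat R) ratr_norm -to_realE.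
  have -> : toR (r m) =
      \sum_(i < size us) (l m i - (q m i * d)%:R) *: toR us`_i.
    rewrite /r to_realB (lP m).2 to_real_sum -sumrB.
    by apply: eq_bigr => i _; rewrite to_realZn scalerBl.
  rewrite summxE (le_trans (ler_norm_sum _ _ _))// /B rmorph_sum/=.
  apply: ler_sum => i _; have /andP[q0 q1] := qP m i.
  rewrite mxE to_realE normrM (ger0_norm q0) -ratr_norm.
  rewrite -[leRHS]/(ratr _) [leRHS](rmorphM (@ratr R))/= ratr_nat.
  by rewrite ler_wpM2r// ler0q.
have rk m : lattice k (r m).
  apply: latticeD => //; first exact: (aP m).2.
  apply: latticeN => //; apply/latticeP => // j.
  rewrite summxE mulr_sumr rpred_sum// => i _.
  by rewrite mxE natrM rpredM ?natr_int// -mulrA rpredM ?natr_int.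
have [N NP] : exists N : nat, forall m j, `|k%:R * r m 0 j| <= N%:R.
  exists (Num.truncn (k%:R * \sum_j B j)).+1 => m j.
  have B0 j' : 0 <= B j' by apply: sumr_ge0 => i _; exact: mulr_ge0.
  apply: le_trans (_ : k%:R * \sum_j B j <= _).
    rewrite normrM ger0_norm// ler_wpM2l// (le_trans (rB m j))//.
    by rewrite (bigD1 j)//= lerDl sumr_ge0.
  by apply/ltW/real_truncnS_gt/ger0_real/mulr_ge0 => //; exact: sumr_ge0.
have nat_up m j : N%:R + k%:R * r m 0 j \is a Num.nat.
  rewrite natrEint rpredD ?natr_int//=; last by have /latticeP := rk m; exact.
  by have := NP m j; rewrite ler_norml => /andP[? ?]; lra.
have nat_dn m j : N%:R - k%:R * r m 0 j \is a Num.nat.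
  rewrite natrEint rpredB ?natr_int//=; last by have /latticeP := rk m; exact.
  by have := NP m j; rewrite ler_norml => /andP[? ?]; lra.
pose f (x : 'I_(size us) + ('I_n + 'I_n)) m : nat :=
  match x with
  | inl i => q m i
  | inr (inl j) => Num.truncn (N%:R + k%:R * r m 0 j)
  | inr (inr j) => Num.truncn (N%:R - k%:R * r m 0 j)
  end.
have [g [ginc gP]] := nat_subseqs f (enum {: 'I_(size us) + ('I_n + 'I_n)}).
exists g; split => // i j ij.
have r_eq : r (g i) = r (g j).
  apply/rowP => c.
  have := gP (inr (inl c)) (mem_enum _ _) _ _ ij.
  have := gP (inr (inr c)) (mem_enum _ _) _ _ ij.
  rewrite /f -!(ler_nat rat) !truncnK// => le1 le2.
  have : k%:R * r (g i) 0 c = k%:R * r (g j) 0 c by lra.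
  by apply: mulfI; rewrite pnatr_eq0 -lt0n.
exists (fun c => if (c < size us)%N then ((q (g j) c - q (g i) c) * d)%:R
                 else 0).
  by move=> c; case: ifP.
have -> : a (g j) - a (g i) =
    \sum_(c < size us) ((q (g j) c - q (g i) c) * d)%:R *: us`_c.
  have aE m : a m = r m + \sum_(i < size us) (q m i * d)%:R *: us`_i.
    by rewrite subrK.
  rewrite !aE r_eq opprD addrACA subrr add0r -sumrB.
  apply: eq_bigr => c _; rewrite -scalerBl -natrB ?mulnBl//.
  by rewrite leq_mul2r (gP (inl c) (mem_enum _ _)) ?orbT.
rewrite to_real_sum; apply: eq_bigr => c _.
by rewrite ltn_ord to_realZn.
Qed.

End Cones.

Section Supports.
Variables (R : realType) (n : nat) (le : additive_order R n).
Implicit Types (us vs : seq 'rV[rat]_n) (a b u : 'rV[rat]_n) (k : nat).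
Local Notation toR := (@to_real R n).
Local Notation cone := (@cone R n).

Lemma ao_refl (u : 'rV[R]_n) : le u u.
Proof. by have := ao_total le u u; rewrite orbb. Qed.

Lemma ao_addr_ge0 (u v : 'rV[R]_n) : le 0 u -> le 0 v -> le 0 (u + v).
Proof.
move=> u0 v0; apply: ao_trans v0 _.
by have := ao_leD v u0; rewrite add0r.
Qed.

Lemma ao_subr_ge0 (u v : 'rV[R]_n) : le 0 (v - u) = le u v.
Proof.
apply/idP/idP => [/(ao_leD u)|/(ao_leD (- u))]; first by rewrite add0r subrK.
by rewrite subrr.
Qed.

Lemma ao_oppr (u : 'rV[R]_n) : le 0 u -> le 0 (- u) -> u = 0.
Proof.
move=> u0 u0'; apply: (@ao_anti _ _ le); rewrite u0 andbT.
by rewrite -ao_subr_ge0 sub0r.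
Qed.

Lemma compatible_cat us vs :
  compatible le us -> compatible le vs -> compatible le (us ++ vs).
Proof.
by move=> cu cv _ /cone_catP[y [z [/cu y0 /cv z0 ->]]]; exact: ao_addr_ge0.
Qed.

Lemma compatible_nil : compatible le [::].
Proof. by move=> _ [l _ ->] /=; rewrite big_ord0; exact: ao_refl. Qed.

Lemma compatible_unit_vectors : compatible le (@unit_vectors n).
Proof. by move=> x /cone_unit_vectors x0; exact: ao_orthant. Qed.

(* Exponents a in (1/k)Z^n such that a + z/k lies in the cone: these are the
   exponents of the series phi with X^{z/k} phi in K_sigma[[X^{1/k}]]. *)
Definition fits k (z : 'rV[int]_n) us : set 'rV[rat]_n :=
  [set a | lattice k a /\ cone us (toR (a + k%:R^-1 *: map_mx intr z))].

Lemma fits_shift k z us a : (0 < k)%N -> fits k z us a ->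
  cone us (toR (a + k%:R^-1 *: map_mx intr z)) /\
  lattice k (a + k%:R^-1 *: map_mx intr z).
Proof.
by move=> k0 [ka ca]; split => //; apply: latticeD => //; exact: lattice_int.
Qed.

Lemma fits_join_le (p q x y : rat) : 0 < p -> 0 < q ->
  p^-1 * x <= (p * q)^-1 * (`|x| * q + `|y| * p).
Proof.
move=> p0 q0.
have -> : (p * q)^-1 * (`|x| * q + `|y| * p) = p^-1 * `|x| + q^-1 * `|y|.
  by field; rewrite !gt_eqF.
rewrite -[leLHS]addr0 lerD ?mulr_ge0 ?invr_ge0 ?(ltW q0)//.
by rewrite ler_wpM2l ?ler_norm// invr_ge0 ltW.
Qed.

Lemma fits_join k z us k' z' us' : (0 < k)%N -> (0 < k')%N ->
  compatible le us -> compatible le us' ->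
  exists z'' us'', [/\ compatible le us'',
    fits k z us `<=` fits (k * k') z'' us'' &
    fits k' z' us' `<=` fits (k * k') z'' us''].
Proof.
move=> k0 k'0 cu cu'.
have kR : 0 < k%:R :> rat by rewrite ltr0n.
have k'R : 0 < k'%:R :> rat by rewrite ltr0n.
pose z'' : 'rV[int]_n := \row_j (`|z 0 j| * k'%:Z + `|z' 0 j| * k%:Z).
exists z'', ((us ++ us') ++ unit_vectors n); split.
- exact: (compatible_cat (compatible_cat cu cu') compatible_unit_vectors).
- move=> a [ka ca]; split; first exact: lattice_mulr.
  have -> : toR (a + (k * k')%:R^-1 *: map_mx intr z'') =
      (toR (a + k%:R^-1 *: map_mx intr z) + 0) +
      toR ((k * k')%:R^-1 *: map_mx intr z'' - k%:R^-1 *: map_mx intr z).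
    by rewrite addr0 -to_realD -addrA subrKC.
  apply: cone_cat; first by apply: cone_cat => //; exact: cone0.
  apply/cone_unit_vectors => j; rewrite !mxE ler0q natrM subr_ge0.
  by rewrite rmorphD !rmorphM/= !intr_norm; exact: fits_join_le.
- move=> a [ka ca]; split; first by rewrite mulnC; exact: lattice_mulr.
  have -> : toR (a + (k * k')%:R^-1 *: map_mx intr z'') =
      (0 + toR (a + k'%:R^-1 *: map_mx intr z')) +
      toR ((k * k')%:R^-1 *: map_mx intr z'' - k'%:R^-1 *: map_mx intr z').
    by rewrite add0r -to_realD -addrA subrKC.
  apply: cone_cat; first by apply: cone_cat => //; exact: cone0.
  apply/cone_unit_vectors => j; rewrite !mxE ler0q natrM subr_ge0.
  rewrite rmorphD !rmorphM/= !intr_norm addrC [k%:R * _]mulrC.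
  exact: fits_join_le.
Qed.

Lemma fits_finite k z z' us (c : 'rV[rat]_n) : (0 < k)%N -> compatible le us ->
  finite_set [set a | fits k z us a /\ fits k z' us (c - a)].
Proof.
move=> k0 cu; apply: contrapT => /infiniteP/ppcard_leP[s].
pose w z : 'rV[rat]_n := k%:R^-1 *: map_mx intr z.
have sP m : fits k z us (s m) /\ fits k z' us (c - s m).
  by have := @funS _ _ _ _ s m I.
have [g [ginc gP]] := cone_lattice_subseq (a := fun m => s m + w z) k0
  (fun m => fits_shift k0 (sP m).1).
have [h [hinc hP]] := cone_lattice_subseq (a := fun m => c - s (g m) + w z') k0
  (fun m => fits_shift k0 (sP (g m)).2).
have d1 : le 0 (toR (s (g (h 1%N)) - s (g (h 0%N)))).
  apply: cu; have := gP _ _ (ltnW (hinc 0%N 1%N isT)).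
  by rewrite opprD addrACA subrr addr0.
have d2 : le 0 (- toR (s (g (h 1%N)) - s (g (h 0%N)))).
  apply: cu; have := hP 0%N 1%N isT.
  rewrite -to_realN opprB opprD addrACA subrr addr0 opprB.
  by rewrite addrC addrA subrK.
have := ao_oppr d1 d2; rewrite -[RHS](@to_real0 R) => /to_real_inj/subr0_eq.
move=> e; have := ginc _ _ (hinc 0%N 1%N isT).
by rewrite (@inj _ _ _ s _ _ _ _ e) ?inE// ltnn.
Qed.

Lemma fits_min k z us (S : set 'rV[rat]_n) : (0 < k)%N -> compatible le us ->
  S `<=` fits k z us -> S !=set0 ->
  exists2 a, S a & forall b, S b -> le (toR a) (toR b).
Proof.
move=> k0 cu SF [a0 Sa0]; apply: contrapT => nomin.
have /choice[next nextP] (a : 'rV[rat]_n) : exists b, S a ->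
    S b /\ ~~ le (toR a) (toR b).
  have [Sa|nSa] := pselect (S a); last by exists a.
  apply: contrapT => nob; apply: nomin; exists a => // b Sb.
  by apply: contrapT => /negP nab; apply: nob; exists b.
pose s m := iter m next a0.
have Ss m : S (s m) by elim: m => //= m IH; exact: (nextP _ IH).1.
have s_lt i j : (i < j)%N -> ~~ le (toR (s i)) (toR (s j)).
  move: i j; apply: (homo_ltn (f := s) (r := fun a b => ~~ le (toR a) (toR b)))
    => [b a c ab bc|i]; last exact: (nextP _ (Ss i)).2.
  apply: contra ab => ac; apply: ao_trans ac _.
  by have := ao_total le (toR b) (toR c); rewrite (negbTE bc).
pose w : 'rV[rat]_n := k%:R^-1 *: map_mx intr z.
have [g [ginc gP]] := cone_lattice_subseq (a := fun m => s m + w) k0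
  (fun m => fits_shift k0 (SF _ (Ss m))).
have /negP := s_lt _ _ (ginc 0%N 1%N isT); apply.
rewrite -ao_subr_ge0 -to_realB; apply: cu; have := gP 0%N 1%N isT.
by rewrite opprD addrACA subrr addr0.
Qed.

End Supports.

(** * The ring of series with bounded denominators *)

Section Convolution.
Variables (R : realType) (n : nat) (le : additive_order R n) (K : fieldType).
Implicit Types (phi psi chi : series n K) (a b c : 'rV[rat]_n) (k : nat).
Local Notation toR := (@to_real R n).

Definition conv phi psi : series n K := fun c =>
  \sum_(a \in [set: 'rV[rat]_n]) phi a * psi (c - a).

Definition series1 : series n K := fun a => (a == 0)%:R.

Lemma fractionalP k phi : (0 < k)%N -> is_fractional_series le k phi <->
  exists z us, compatible le us /\ Supp phi `<=` fits R k z us.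
Proof.
move=> k0; split=> [[z [us cu sub]]|[z [us [cu sub]]]].
  exists z, us; split => // a phia.
  pose w : 'rV[rat]_n := k%:R^-1 *: map_mx intr z.
  have /sub[ca ka] : Supp (mul_monomial w phi) (a + w).
    by rewrite /Supp /mul_monomial /= addrK.
  split => //; rewrite -(addrK w a); apply: latticeD => //.
  by apply: latticeN => //; exact: lattice_int.
exists z, us => // a /sub /(fits_shift k0).
by rewrite subrK.
Qed.

Lemma fractional_join k k' phi psi : (0 < k)%N -> (0 < k')%N ->
  is_fractional_series le k phi -> is_fractional_series le k' psi ->
  exists z us, [/\ compatible le us, Supp phi `<=` fits R (k * k') z us &
                   Supp psi `<=` fits R (k * k') z us].
Proof.
move=> k0 k'0 /(fractionalP _ k0)[z [us [cu su]]].
move=> /(fractionalP _ k'0)[z' [us' [cu' su']]].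
have [z'' [us'' [cu'' s s']]] := fits_join z z' k0 k'0 cu cu'.
by exists z'', us''; split => //; [exact: subset_trans s|exact: subset_trans s'].
Qed.

Lemma puiseuxP phi : phi \in is_puiseux le <->
  exists k, [/\ (0 < k)%N & is_fractional_series le k phi].
Proof.
by split=> [/asboolP[k k0 H]|[k [k0 H]]]; [|apply/asboolP]; exists k.
Qed.

Lemma puiseux_join phi psi : phi \in is_puiseux le -> psi \in is_puiseux le ->
  exists k z us, [/\ (0 < k)%N, compatible le us,
    Supp phi `<=` fits R k z us & Supp psi `<=` fits R k z us].
Proof.
move=> /puiseuxP[k [k0 pk]] /puiseuxP[k' [k'0 pk']].
have [z [us [cu s s']]] := fractional_join k0 k'0 pk pk'.
by exists (k * k')%N, z, us; split => //; rewrite muln_gt0 k0.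
Qed.

Lemma puiseux_join3 phi psi chi : phi \in is_puiseux le ->
  psi \in is_puiseux le -> chi \in is_puiseux le ->
  exists k z us, [/\ (0 < k)%N, compatible le us,
    Supp phi `<=` fits R k z us, Supp psi `<=` fits R k z us &
    Supp chi `<=` fits R k z us].
Proof.
move=> p1 p2 /puiseuxP[k' [k'0 /(fractionalP _ k'0)[z' [us' [cu' s3]]]]].
have [k [z [us [k0 cu s1 s2]]]] := puiseux_join p1 p2.
have [z'' [us'' [cu'' s s']]] := fits_join z z' k0 k'0 cu cu'.
exists (k * k')%N, z'', us''; split => //; first by rewrite muln_gt0 k0.
- exact: subset_trans s.
- exact: subset_trans s.
- exact: subset_trans s'.
Qed.

Lemma Supp_sub phi psi :
  Supp (phi - psi) `<=` Supp phi `|` Supp psi.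
Proof.
move=> a; rewrite /Supp /=.
have -> : (phi - psi) a = phi a - psi a by [].
have [->|] := eqVneq (phi a) 0; last by left.
by rewrite sub0r oppr_eq0; right.
Qed.

Lemma fits_add k (z : 'rV[int]_n) us a b : (0 < k)%N ->
  fits R k z us a -> fits R k z us b -> fits R k (z + z) us (a + b).
Proof.
move=> k0 [ka ca] [kb cb]; split; first exact: latticeD.
by rewrite map_mxD scalerDr addrACA to_realD; exact: coneD.
Qed.

Lemma conv_neq0 phi psi c : conv phi psi c != 0 ->
  exists2 a, phi a != 0 & psi (c - a) != 0.
Proof.
move=> H; apply: contrapT => no; move: H; rewrite /conv fsbig1 ?eqxx// => a _.
apply: contrapT => /eqP; rewrite mulf_eq0 negb_or => /andP[? ?].
by apply: no; exists a.
Qed.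

Lemma Supp_conv k z us phi psi : (0 < k)%N ->
  Supp phi `<=` fits R k z us -> Supp psi `<=` fits R k z us ->
  Supp (conv phi psi) `<=` fits R k (z + z) us.
Proof.
move=> k0 s1 s2 c /conv_neq0[a /s1 a1 /s2 a2].
by rewrite -(subrKC a c); exact: fits_add.
Qed.

Lemma conv_fsetE (A : {fset 'rV[rat]_n}) phi psi c :
  (forall a, phi a != 0 -> psi (c - a) != 0 -> a \in A) ->
  conv phi psi c = \sum_(a <- A) phi a * psi (c - a).
Proof.
move=> HA; apply: fsbigTE => a aA; apply: contrapT => /eqP.
by rewrite mulf_eq0 negb_or => /andP[/HA/[apply]]; rewrite (negPf aA).
Qed.

Definition fits_fset k (z z' : 'rV[int]_n) us c : {fset 'rV[rat]_n} :=
  fset_set [set a | fits R k z us a /\ fits R k z' us (c - a)].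

Lemma in_fits_fset k z z' us c a : (0 < k)%N -> compatible le us ->
  a \in fits_fset k z z' us c <-> fits R k z us a /\ fits R k z' us (c - a).
Proof.
move=> k0 cu; rewrite /fits_fset in_fset_set ?inE//.
exact: (fits_finite _ _ _ k0 cu).
Qed.

Lemma convC : commutative conv.
Proof.
move=> phi psi; apply/funext => c; rewrite /conv.
rewrite (@reindex_fsbigT _ _ _ _ _ (fun a => c - a)); last first.
  by exists (fun a => c - a) => a; rewrite subKr.
by apply: eq_fsbigr => a _; rewrite subKr mulrC.
Qed.

Lemma conv1 phi : conv series1 phi = phi.
Proof.
apply/funext => c; rewrite /conv (fsbigTE [fset 0]%fset) => [|a].
  by rewrite big_seq_fset1 /series1 eqxx mul1r subr0.
by rewrite inE /series1 => /negPf->; rewrite mul0r.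
Qed.

Lemma convDl phi psi chi : phi \in is_puiseux le -> psi \in is_puiseux le ->
  chi \in is_puiseux le -> conv (phi + psi) chi = conv phi chi + conv psi chi.
Proof.
move=> p1 p2 p3; apply/funext => c.
have [k [z [us [k0 cu s1 s2 s3]]]] := puiseux_join3 p1 p2 p3.
have s12 : Supp (phi + psi) `<=` fits R k z us.
  rewrite -[psi]opprK => a /Supp_sub[/s1//|].
  by rewrite /Supp /= => H; apply: s2; rewrite /Supp /= -oppr_eq0.
rewrite [RHS]/(conv phi chi c + conv psi chi c).
rewrite !(conv_fsetE (A := fits_fset k z z us c)); first last.
- by move=> a /s12 ? /s3 ?; apply/(in_fits_fset _ _ _ _ k0 cu); split.
- by move=> a /s1 ? /s3 ?; apply/(in_fits_fset _ _ _ _ k0 cu); split.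
- by move=> a /s2 ? /s3 ?; apply/(in_fits_fset _ _ _ _ k0 cu); split.
rewrite (eq_bigr (fun a => phi a * chi (c - a) + psi a * chi (c - a))).
  exact: big_split.
by move=> a _; exact: mulrDl.
Qed.

Lemma convA phi psi chi : phi \in is_puiseux le -> psi \in is_puiseux le ->
  chi \in is_puiseux le -> conv phi (conv psi chi) = conv (conv phi psi) chi.
Proof.
move=> p1 p2 p3; apply/funext => c.
have [k [z [us [k0 cu s1 s2 s3]]]] := puiseux_join3 p1 p2 p3.
have s12 := Supp_conv k0 s1 s2; have s23 := Supp_conv k0 s2 s3.
have addF a b := @fits_add k z us a b k0.
move: (z + z) s12 s23 addF => w s12 s23 addF.
have [A AP] : exists A : {fset 'rV[rat]_n}, forall a,
    a \in A <-> fits R k z us a /\ fits R k w us (c - a).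
  by exists (fits_fset k z w us c) => a; exact: in_fits_fset.
have [B BP] : exists B : {fset 'rV[rat]_n}, forall b,
    b \in B <-> fits R k w us b /\ fits R k z us (c - b).
  by exists (fits_fset k w z us c) => b; exact: in_fits_fset.
rewrite (conv_fsetE (A := A)); last first.
  by move=> a /s1 fa /s23 fb; apply/AP; split; [exact: fa|exact: fb].
rewrite [RHS](conv_fsetE (A := B)); last first.
  by move=> b /s12 fa /s3 fb; apply/BP; split; [exact: fa|exact: fb].
transitivity (\sum_(a <- A) \sum_(b <- B) phi a * psi (b - a) * chi (c - b)).
  apply: eq_big_seq => a /AP[fa fca].
  rewrite /conv (@reindex_fsbigT _ _ _ _ _ (fun b => b - a)); last first.
    by exists (fun b => b + a) => b; rewrite (subrK, addrK).
  rewrite (fsbigTE B) => [|b bB].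
    by rewrite mulr_sumr; apply: eq_bigr => b _; rewrite mulrA opprB addrA subrK.
  apply: contrapT => /eqP; rewrite opprB addrA subrK mulf_eq0 negb_or.
  move=> /andP[/s2 fb /s3 fc]; move/negP: bB; apply; apply/BP.
  by split; [have := addF _ _ fb fa; rewrite subrK|exact: fc].
rewrite exchange_big; apply: eq_big_seq => b /BP[fb fcb].
rewrite (conv_fsetE (A := A)) ?mulr_suml// => a /s1 fa /s2 fba.
apply/AP; split; first exact: fa.
by have := addF _ _ fcb fba; rewrite addrA subrK.
Qed.

Lemma fractional_conv k k' phi psi : (0 < k)%N -> (0 < k')%N ->
  is_fractional_series le k phi -> is_fractional_series le k' psi ->
  is_fractional_series le (k * k') (conv phi psi).
Proof.
move=> k0 k'0 p1 p2; have [z [us [cu s1 s2]]] := fractional_join k0 k'0 p1 p2.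
have kk0 : (0 < k * k')%N by rewrite muln_gt0 k0.
apply/(fractionalP _ kk0); exists (z + z), us; split => //.
exact: Supp_conv.
Qed.

Lemma fractional_sub k k' phi psi : (0 < k)%N -> (0 < k')%N ->
  is_fractional_series le k phi -> is_fractional_series le k' psi ->
  is_fractional_series le (k * k') (phi - psi).
Proof.
move=> k0 k'0 p1 p2; have [z [us [cu s1 s2]]] := fractional_join k0 k'0 p1 p2.
have kk0 : (0 < k * k')%N by rewrite muln_gt0 k0.
apply/(fractionalP _ kk0); exists z, us; split => //.
by move=> a /Supp_sub[/s1|/s2].
Qed.

Lemma fractional_series1 k : (0 < k)%N -> is_fractional_series le k series1.
Proof.
move=> k0; apply/(fractionalP _ k0); exists 0, [::].
split; first exact: compatible_nil.
move=> a; rewrite /Supp /series1 /=.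
case: (eqVneq a 0) => [-> _|_]; last by rewrite eqxx.
split; first exact: lattice0.
by rewrite map_mx0 scaler0 addr0 to_real0; exact: cone0.
Qed.

Lemma fractional_series0 k : (0 < k)%N ->
  is_fractional_series le k (0 : series n K).
Proof.
move=> k0; apply/(fractionalP _ k0); exists 0, [::].
by split; [exact: compatible_nil|move=> a; rewrite /Supp/= eqxx].
Qed.

Lemma fractional_orthant phi :
  (forall a, Supp phi a -> exists m : 'I_n -> nat, forall j, a 0 j = (m j)%:R) ->
  is_fractional_series le 1 phi.
Proof.
move=> H; apply/fractionalP => //; exists 0, (@unit_vectors n).
split=> [|a /H[m mE]]; first exact: compatible_unit_vectors.
split=> [j|]; first by exists (m j); rewrite mE divr1.
rewrite map_mx0 scaler0 addr0; apply/cone_unit_vectors => j.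
by rewrite to_realE mE ler0q.
Qed.

Lemma puiseux_conv phi psi : phi \in is_puiseux le -> psi \in is_puiseux le ->
  conv phi psi \in is_puiseux le.
Proof.
move=> /puiseuxP[k [k0 p1]] /puiseuxP[k' [k'0 p2]].
apply/puiseuxP; exists (k * k')%N.
by split; [rewrite muln_gt0 k0|exact: fractional_conv].
Qed.

Lemma puiseux_series1 : series1 \in is_puiseux le.
Proof. by apply/puiseuxP; exists 1%N; split => //; exact: fractional_series1. Qed.

Fact puiseux_zmod_closed : zmod_closed (@is_puiseux R n K le).
Proof.
split=> [|phi psi].
  by apply/puiseuxP; exists 1%N; split => //; exact: fractional_series0.
move=> /puiseuxP[k [k0 p1]] /puiseuxP[k' [k'0 p2]].
apply/puiseuxP; exists (k * k')%N.
by split; [rewrite muln_gt0 k0|exact: fractional_sub].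
Qed.

Lemma conv_lead phi psi a b :
  (forall a', phi a' != 0 -> le (toR a) (toR a')) ->
  (forall b', psi b' != 0 -> le (toR b) (toR b')) ->
  conv phi psi (a + b) = phi a * psi b.
Proof.
move=> amin bmin; rewrite (conv_fsetE (A := [fset a]%fset)) => [|a' pa' pb'].
  by rewrite big_seq_fset1 addrC addKr.
rewrite inE; apply/eqP/(@to_real_inj R)/(@ao_anti _ _ le).
rewrite (amin _ pa') andbT -ao_subr_ge0 -to_realB.
by have := bmin _ pb'; rewrite -ao_subr_ge0 -to_realB addrAC addrK.
Qed.

Lemma puiseux_min phi : phi \in is_puiseux le -> phi <> 0 ->
  exists2 a, phi a != 0 & forall b, phi b != 0 -> le (toR a) (toR b).
Proof.
move=> /puiseuxP[k [k0 /(fractionalP _ k0)[z [us [cu su]]]]] phi0.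
apply: (fits_min k0 cu su); apply: contrapT => no; apply: phi0.
apply/funext => a; apply: contrapT => /eqP pa; apply: no; by exists a.
Qed.

End Convolution.

HB.instance Definition _ (R : realType) (n : nat) (K : fieldType)
  (le : additive_order R n) := GRing.isZmodClosed.Build _
    (@is_puiseux R n K le) (puiseux_zmod_closed le K).

(* The ring K_le((X^* )). *)
Record puiseux (R : realType) (n : nat) (K : fieldType)
  (le : additive_order R n) := Puiseux {
  coefs : series n K ;
  _ : coefs \in is_puiseux le }.
Arguments puiseux {R n} K le.

(* Used to give integral domains that are not known to be fields a unit ring
   structure whose units are exactly the invertible elements. *)
Section ClassicalUnits.
Variable A : comNzRingType.

Definition class_unit : {pred A} := fun x => `[< exists y, y * x = 1 >].
Definition class_inv (x : A) : A :=
  if pselect (exists y, y * x = 1) is left e then sval (cid e) else x.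

Lemma class_mulVr : {in class_unit, left_inverse 1 class_inv *%R}.
Proof.
move=> x /asboolP ex; rewrite /class_inv; case: pselect => // e.
by case: cid.
Qed.

Lemma class_unitPl (x y : A) : y * x = 1 -> x \in class_unit.
Proof. by move=> yx; apply/asboolP; exists y. Qed.

Lemma class_invr_out : {in [predC class_unit], class_inv =1 id}.
Proof.
move=> x nx; rewrite /class_inv; case: pselect => // e.
by case/negP: nx; apply/asboolP.
Qed.

End ClassicalUnits.

Section PuiseuxRing.
Variables (R : realType) (n : nat) (K : fieldType) (le : additive_order R n).
Local Notation P := (puiseux K le).

HB.instance Definition _ := [isSub of P for @coefs R n K le].
HB.instance Definition _ := gen_eqMixin P.
HB.instance Definition _ := gen_choiceMixin P.
HB.instance Definition _ := [SubChoice_isSubZmodule of P by <:].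

Definition puiseux_mul (x y : P) : P := Puiseux (puiseux_conv (valP x) (valP y)).
Definition puiseux_one : P := Puiseux (puiseux_series1 le K).

Fact puiseux_mulA : associative puiseux_mul.
Proof. by move=> x y z; apply/val_inj/convA; exact: valP. Qed.
Fact puiseux_mulC : commutative puiseux_mul.
Proof. by move=> x y; apply/val_inj/convC. Qed.
Fact puiseux_mul1 : left_id puiseux_one puiseux_mul.
Proof. by move=> x; apply/val_inj/conv1. Qed.
Fact puiseux_mulDl : left_distributive puiseux_mul +%R.
Proof. by move=> x y z; apply/val_inj/convDl; exact: valP. Qed.
Fact puiseux_one_neq0 : puiseux_one != 0.
Proof.
apply/eqP => /(congr1 (fun x : P => coefs x 0)).
by rewrite /= /series1 eqxx => /eqP; rewrite oner_eq0.
Qed.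

HB.instance Definition _ := GRing.Zmodule_isComNzRing.Build P
  puiseux_mulA puiseux_mulC puiseux_mul1 puiseux_mulDl puiseux_one_neq0.

Lemma puiseux_mulf_eq0 (x y : P) : x * y = 0 -> (x == 0) || (y == 0).
Proof.
move=> xy0; apply: contrapT => /negP; rewrite negb_or => /andP[/eqP x0 /eqP y0].
have [|a xa amin] := puiseux_min (valP x); first by move=> /(@val_inj _ _ _ x 0).
have [|b yb bmin] := puiseux_min (valP y); first by move=> /(@val_inj _ _ _ y 0).
have := conv_lead amin bmin; rewrite -[conv _ _]/(val (x * y)) xy0 => /esym/eqP.
by rewrite mulf_eq0 (negPf xa) (negPf yb).
Qed.

HB.instance Definition _ := GRing.ComNzRing_hasMulInverse.Build P
  (@class_mulVr P) (@class_unitPl P) (@class_invr_out P).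
HB.instance Definition _ := GRing.ComUnitRing_isIntegral.Build P
  puiseux_mulf_eq0.

(* The subring K_le((X)) of K_le((X^* )). *)
Definition is_laurent : {pred P} := fun x =>
  `[< is_fractional_series le 1 (coefs x) >].

Fact laurent_subring_closed : subring_closed is_laurent.
Proof.
split=> [|x y /asboolP px /asboolP py|x y /asboolP px /asboolP py].
- by apply/asboolP; exact: fractional_series1.
- by apply/asboolP; exact: (@fractional_sub _ _ _ _ 1 1).
- by apply/asboolP; exact: (@fractional_conv _ _ _ _ 1 1).
Qed.

HB.instance Definition _ := GRing.isSubringClosed.Build P is_laurent
  laurent_subring_closed.

End PuiseuxRing.

Record laurent (R : realType) (n : nat) (K : fieldType)
  (le : additive_order R n) := Laurent {
  laurent_val : puiseux K le ;
  _ : laurent_val \in @is_laurent R n K le }.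
Arguments laurent {R n} K le.

Section LaurentRing.
Variables (R : realType) (n : nat) (K : fieldType) (le : additive_order R n).
Local Notation L := (laurent K le).

HB.instance Definition _ := [isSub of L for @laurent_val R n K le].
HB.instance Definition _ := [Choice of L by <:].
HB.instance Definition _ := [SubChoice_isSubComNzRing of L by <:].

Fact laurent_mulf_eq0 (x y : L) : x * y = 0 -> (x == 0) || (y == 0).
Proof.
move=> /(congr1 val); rewrite rmorphM rmorph0 => /puiseux_mulf_eq0.
by rewrite -!(inj_eq val_inj) rmorph0.
Qed.

HB.instance Definition _ := GRing.ComNzRing_hasMulInverse.Build L
  (@class_mulVr L) (@class_unitPl L) (@class_invr_out L).
HB.instance Definition _ := GRing.ComUnitRing_isIntegral.Build L
  laurent_mulf_eq0.

End LaurentRing.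

(** * Valuation and value sets *)

Section ValueSets.
Variables (R : realType) (n : nat) (K : fieldType) (le : additive_order R n).
Local Notation P := (puiseux K le).
Local Notation L := (laurent K le).

(* K[[X]], the series with support in N^n; by fractional_orthant every such
   series lies in K_le((X)). *)
Definition power_series : {pred L} := fun x =>
  `[< forall a, Supp (coefs (val x)) a ->
        exists m : 'I_n -> nat, forall j, a 0 j = (m j)%:R >].

(* Junk value 0 when phi = 0; otherwise the minimum exists by puiseux_min. *)
Definition nu (phi : P) : 'rV[rat]_n :=
  xget 0 [set a | Supp (coefs phi) a /\
    forall b, Supp (coefs phi) b -> le (to_real R a) (to_real R b)].

Lemma nuP (phi : P) : phi != 0 -> coefs phi (nu phi) != 0 /\
  forall b, coefs phi b != 0 -> le (to_real R (nu phi)) (to_real R b).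
Proof.
move=> phi0; rewrite /nu; case: xgetP => [a _ []//|no].
have [|a pa amin] := puiseux_min (valP phi).
  by move=> /(@val_inj _ _ _ phi 0)/eqP; exact/negP.
by case: (no a).
Qed.

(* The ideal (y - xi) of K_le((X^* ))[y]. *)
Definition in_root_ideal (xi : P) (p : {poly P}) : Prop :=
  exists q : {poly P}, p = q * ('X - xi%:P).

Definition value_set (A : {pred L}) (xi : P) : set 'rV[rat]_n :=
  [set nu (map_poly val h).[xi] | h in
    [set h : {poly L} | h \is a polyOver A /\
                        ~ in_root_ideal xi (map_poly val h)]].

End ValueSets.
Arguments power_series {R n K le}.

(* Irreducibility of an element of a domain.  On polynomials over a domain,
   irreducible_poly is irreducibility over the fraction field instead; for
   monic polynomials over a field the two agree. *)
Definition irreducible_elt (A : unitRingType) (p : A) : Prop :=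
  [/\ p != 0, p \isn't a GRing.unit &
      forall a b : A, p = a * b -> a \is a GRing.unit \/ b \is a GRing.unit].

(* Main.v *)
Require Import Defs.
From HB Require Import structures.
From mathcomp Require Import all_boot all_order all_algebra.
From mathcomp Require Import boolp classical_sets reals fsbigop.

(** The roots of [f] are conjugate under an explicit group of automorphisms of
    K((X^* )), and these automorphisms do not move the valuation.

    A character [c] of Q^n with values in K^* that is trivial on Z^n acts on
    series by multiplying the coefficient of X^a by [c a] ([twist]).  This is
    the usual substitution of [zeta_j x_j^(1/k)] for [x_j^(1/k)], written so
    that one formula serves all denominators k at once.  The action is
    multiplicative because [c] is, it preserves supports because [c] never
    vanishes, and it fixes K((X)) because [c] is trivial on Z^n.  Hence
    [h(twist c xi) = twist c (h(xi))] has the same valuation as [h(xi)] for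
    every polynomial [h] over K((X)), and value sets are constant on orbits
    ([value_set_twist]).

    It remains to see that [f] has a single orbit of roots
    ([conjugate_roots]).  The orbit of [xi] consists of roots of [f], so it is
    finite; let [g] be the product of the [y - eta] over [eta] in the orbit.
    Its coefficients are fixed by all characters.  As K is algebraically closed
    of characteristic zero, the characters separate the points of Q^n outside
    Z^n from 0 ([lattice_separation]), so the coefficients of [g] lie in K((X))
    ([laurent_fixed]).  The remainder of [f] by the monic [g] vanishes on the
    whole orbit and has degree less than its cardinal, so [g] divides [f] over
    K((X)).  Irreducibility of [f] then makes [f] a unit times [g], whose roots
    are exactly the orbit.

    This argument divides only by monic polynomials, so it never inverts an
    element of K((X)): it holds for every additive order, including those for
    which the rings of series are merely integral domains. *)

Set Implicit Arguments.
Unset Strict Implicit.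
Unset Printing Implicit Defensive.

Import Order.TTheory GRing.Theory Num.Theory.

Local Open Scope classical_set_scope.
Local Open Scope ring_scope.

(** * Multiplicative characters of the rational numbers *)

Section RationalCharacters.
Variable K : closedFieldType.

Lemma nth_root (x : K) (m : nat) : exists y, y ^+ m.+1 = x.
Proof.
have [y yE] := solve_monicpoly (nth 0 [:: x]) (ltn0Sn m).
exists y; rewrite yE big_ord_recl /= expr0 mulr1 big1 ?addr0// => i _.
by rewrite /= nth_nil mul0r.
Qed.

(** A root of 1 + X + ... + X^(k-1) will do: this polynomial divides X^k - 1,
    and its value k at 1 is nonzero in characteristic zero. *)
Lemma nontrivial_unity_root (k : nat) : [pchar K] =i pred0 -> (1 < k)%N ->
  exists2 z : K, z ^+ k = 1 & z != 1.
Proof.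
move=> /pcharf0P charK; case: k => [|[|k]] // _.
have [z zE] := solve_monicpoly (fun=> - 1 : K) (ltn0Sn k).
have sum0 : \sum_(i < k.+2) z ^+ i = 0.
  rewrite big_ord_recr /= zE -big_split big1 //= => i _.
  by rewrite mulN1r subrr.
exists z; first by apply/eqP; rewrite -subr_eq0 subrX1 sum0 mulr0.
apply: contra_eq_neq sum0 => ->.
rewrite (eq_bigr (fun=> 1)) => [|i _]; last exact: expr1n.
by rewrite sumr_const card_ord charK.
Qed.

(** The group K^* is divisible, so 1 |-> z extends from Z to Q.  Concretely,
    choose [v m] to be a compatible system of [m!]-th roots of [z] and send
    [q] to the power [q * m!] of [v m], for any [m] large enough to clear the
    denominator of [q]. *)
Lemma rational_powers (z : K) : z != 0 ->
  exists2 phi : rat -> K, {morph phi : a b / a + b >-> a * b} & phi 1 = z.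
Proof.
move=> z0.
have /choice[r rP] (p : K * nat) : exists y, y ^+ p.2.+1 = p.1.
  exact: nth_root.
pose v := fix v m := if m is m'.+1 then r (v m', m') else z.
have vS m : v m.+1 ^+ m.+1 = v m by rewrite [v m.+1]/= rP.
have v0 m : v m != 0.
  by elim: m => // m IH; apply: contraNneq IH => vm0; rewrite -vS vm0 expr0n.
pose e m q := v m ^ numq (q * m`!%:R).
have eS m q : q * m`!%:R \is a Num.int ->
    e m.+1 q = e m q /\ q * (m.+1)`!%:R \is a Num.int.
  move=> /intrP[t tE].
  have tE' : q * (m.+1)`!%:R = (m.+1%:Z * t)%:~R.
    by rewrite factS natrM mulrCA tE rmorphM.
  split; last by rewrite tE' intr_int.
  rewrite /e tE' tE !numq_int -exprz_exp.
  by rewrite -[_ ^ m.+1]/(v m.+1 ^+ m.+1) vS.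
have eD m d q : q * m`!%:R \is a Num.int ->
    e (d + m)%N q = e m q /\ q * (d + m)`!%:R \is a Num.int.
  move=> qm; elim: d => [|d [IH1 IH2]] //.
  by have [E ?] := eS _ _ IH2; rewrite addSn E IH1.
have den q : q * (`|denq q|%N)`!%:R \is a Num.int.
  have qd : q * `|denq q|%N%:R = (numq q)%:~R.
    rewrite -{1}[q]divq_num_den pmulrn abszE ger0_norm ?denq_ge0//.
    by rewrite divfK// intr_eq0 denq_neq0.
  have : (0 < `|denq q|)%N by rewrite absz_gt0 denq_neq0.
  move: qd; case: `|denq q|%N => [|m] // qd _.
  by rewrite factS natrM mulrA qd rpredM ?intr_int ?natr_int.
have phiE q m : (`|denq q| <= m)%N ->
    e `|denq q|%N q = e m q /\ q * m`!%:R \is a Num.int.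
  by move=> /subnK<-; have [-> ?] := eD _ (m - `|denq q|)%N _ (den q).
exists (fun q => e `|denq q|%N q) => [a b|]; last first.
  rewrite (_ : `|denq 1|%N = 1%N) // /e mul1r.
  by rewrite -[1`!%:R]/(1%:~R) numq_int -[LHS]/(v 1%N ^+ 1) vS.
pose M := maxn `|denq (a + b)| (maxn `|denq a| `|denq b|).
have [-> _] := phiE (a + b) M (leq_maxl _ _).
have [|-> /intrP[s sE]] := phiE a M; first by rewrite !leq_max leqnn orbT.
have [|-> /intrP[t tE]] := phiE b M; first by rewrite !leq_max leqnn !orbT.
by rewrite /e mulrDl sE tE -rmorphD !numq_int expfzDr.
Qed.

Lemma exp_morph_int (phi : rat -> K) (m : int) :
  {morph phi : a b / a + b >-> a * b} -> phi 1 != 0 -> phi m%:~R = phi 1 ^ m.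
Proof.
move=> phiD p10.
have phi0 : phi 0 = 1 by apply: (mulfI p10); rewrite -phiD addr0 mulr1.
have phin (k : nat) : phi k%:R = phi 1 ^+ k.
  elim: k => [|k IH]; first by rewrite phi0.
  by rewrite -natr1 phiD IH exprSr.
case: m => k; first exact: phin.
have zk : phi 1 ^+ k.+1 != 0 by rewrite expf_neq0.
apply: (mulIf zk).
by rewrite -{1}phin -phiD NegzE mulrNz -pmulrn addNr phi0 mulVf.
Qed.

(** Let k > 1 be the denominator of [q] and [z] a k-th root of unity other
    than 1.  The character sending 1/k to [z] is trivial on Z.  It cannot be
    trivial at [q], because 1/k is an integral combination of 1 and [q]. *)
Lemma separating_character (q : rat) : [pchar K] =i pred0 ->
  q \isn't a Num.int ->
  exists2 chi : rat -> K, {morph chi : a b / a + b >-> a * b} &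
    chi 1 = 1 /\ chi q != 1.
Proof.
move=> charK qint; set k := `|denq q|%N.
have k1 : (1 < k)%N.
  rewrite ltn_neqAle eq_sym absz_gt0 denq_neq0 andbT.
  apply: contraNneq qint => k1; rewrite Qint_def.
  by rewrite -[denq q]ger0_norm ?denq_ge0// -abszE -/k k1.
have kE : denq q = k%:Z by rewrite /k abszE ger0_norm ?denq_ge0.
have [z zk z1] := nontrivial_unity_root charK k1.
have z0 : z != 0.
  apply: contra_eq_neq zk => ->.
  by rewrite expr0n gtn_eqF ?(ltnW k1)// eq_sym oner_neq0.
have [phi phiD phi1] := rational_powers z0.
have phiz (m : int) : phi m%:~R = z ^ m by rewrite exp_morph_int ?phi1.
exists (fun a => phi (a * k%:R)) => [a b|]; first by rewrite mulrDl phiD.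
rewrite mul1r pmulrn phiz -[_ ^ _]/(z ^+ k) zk; split => //.
rewrite -[q]divq_num_den kE divfK ?pnatr_eq0 -?lt0n ?(ltnW k1)// phiz.
apply: contra_neq z1 => zn.
have /coprimezP[[u w] /= uw] : coprimez (numq q) (denq q).
  exact: coprime_num_den.
have -> : z = z ^ (u * numq q + w * denq q) by rewrite uw expr1z.
have zk' : z ^ denq q = 1 by rewrite kE.
rewrite expfzDr // [u * _]mulrC [w * _]mulrC -!exprz_exp zn zk'.
by rewrite !exp1rz mulr1.
Qed.

End RationalCharacters.

(** * Characters of Q^n trivial on Z^n *)

Record lattice_char (n : nat) (K : fieldType) := LatticeChar {
  char_fun :> 'rV[rat]_n -> K ;
  charD : {morph char_fun : a b / a + b >-> a * b} ;
  char_int : forall a, lattice 1 a -> char_fun a = 1 }.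

Section LatticeCharacters.
Variables (n : nat) (K : fieldType).
Implicit Types (c d : lattice_char n K) (a b : 'rV[rat]_n).

Lemma char_neq0 c a : c a != 0.
Proof.
have : c a * c (- a) != 0.
  by rewrite -charD subrr char_int ?oner_neq0//; exact: lattice0.
by apply: contra_neq => ->; rewrite mul0r.
Qed.

Fact char1D : {morph (fun=> 1) : a b / (a : 'rV[rat]_n) + b >-> (a : K) * b}.
Proof. by move=> a b; rewrite mulr1. Qed.

Definition char1 : lattice_char n K :=
  LatticeChar char1D (fun _ _ => erefl).

Fact char_mulD c d : {morph (fun a => c a * d a) : a b / a + b >-> a * b}.
Proof. by move=> a b; rewrite !charD mulrACA. Qed.

Fact char_mul_int c d a : lattice 1 a -> c a * d a = 1.
Proof. by move=> a1; rewrite !char_int ?mulr1. Qed.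

Definition char_mul c d : lattice_char n K :=
  LatticeChar (char_mulD c d) (@char_mul_int c d).

End LatticeCharacters.

Lemma lattice_separation (n : nat) (K : closedFieldType) (a : 'rV[rat]_n) :
  [pchar K] =i pred0 -> (forall c : lattice_char n K, c a = 1) -> lattice 1 a.
Proof.
move=> charK ca; apply/latticeP => // j; rewrite mul1r.
apply: contrapT => /negP.
move=> /(separating_character charK)[chi chiD [chi1 /eqP]]; apply.
have cD : {morph (fun b : 'rV[rat]_n => chi (b 0 j)) : x y / x + y >-> x * y}.
  by move=> x y; rewrite mxE chiD.
have cint b : lattice 1 b -> chi (b 0 j) = 1.
  move=> /(_ j)[z ->]; rewrite divr1 exp_morph_int ?chi1 ?oner_neq0//.
  exact: exp1rz.
exact: (ca (LatticeChar cD cint)).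
Qed.

(** * The action of characters on series *)

Section Twist.
Variables (R : realType) (n : nat) (K : fieldType) (le : additive_order R n).
Local Notation P := (puiseux K le).
Implicit Types (c d : lattice_char n K) (phi psi : series n K) (x y : P).

Definition twist_series c phi : series n K := fun a => c a * phi a.

Lemma Supp_twist c phi : Supp (twist_series c phi) = Supp phi.
Proof.
apply/funext => a; apply/propext.
by rewrite /Supp /twist_series /= mulf_eq0 (negPf (char_neq0 c a)).
Qed.

Lemma conv_twist c phi psi :
  conv (twist_series c phi) (twist_series c psi) = twist_series c (conv phi psi).
Proof.
apply/funext => e; rewrite /twist_series /conv mulr_fsumr.
apply: eq_fsbigr => a _.
by rewrite mulrACA -charD subrKC.
Qed.

Lemma eq_Supp_fractional k phi psi : (0 < k)%N -> Supp psi = Supp phi ->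
  is_fractional_series le k phi -> is_fractional_series le k psi.
Proof.
move=> k0 E /(fractionalP _ _ k0) H; apply/(fractionalP _ _ k0).
by rewrite E.
Qed.

Fact puiseux_twist c x : twist_series c (coefs x) \in is_puiseux le.
Proof.
have /puiseuxP[k [k0 xk]] := valP x; apply/puiseuxP; exists k; split => //.
by apply: eq_Supp_fractional xk => //; exact: Supp_twist.
Qed.

Definition twist c x : P := Puiseux (puiseux_twist c x).

Fact twist_is_zmod_morphism c : zmod_morphism (twist c).
Proof. by move=> x y; apply/val_inj/funext => a; exact: mulrBr. Qed.

Fact twist_is_monoid_morphism c : monoid_morphism (twist c).
Proof.
split=> [|x y]; apply/val_inj; last by rewrite /= -conv_twist.
apply/funext => a; rewrite /= /twist_series /series1.
have [->|_] := eqVneq a 0; rewrite ?mulr0// mulr1 char_int//.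
exact: lattice0.
Qed.

HB.instance Definition _ c :=
  GRing.isZmodMorphism.Build P P (twist c) (@twist_is_zmod_morphism c).
HB.instance Definition _ c :=
  GRing.isMonoidMorphism.Build P P (twist c) (@twist_is_monoid_morphism c).

Lemma twist_inj c : injective (twist c).
Proof.
move=> x y /(congr1 val) xy; apply/val_inj/funext => a.
exact: (mulfI (char_neq0 c a) (congr1 (@^~ a) xy)).
Qed.

Lemma twist1 x : twist (char1 n K) x = x.
Proof. by apply/val_inj/funext => a; exact: mul1r. Qed.

Lemma twistM c d x : twist (char_mul c d) x = twist c (twist d x).
Proof. by apply/val_inj/funext => a; rewrite /= /twist_series mulrA. Qed.

Lemma nu_twist c x : nu (twist c x) = nu x.
Proof. by rewrite /nu /= Supp_twist. Qed.

(** A Puiseux series with integral exponents a has the a + z/k in a compatible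
    cone for some k and z.  Rounding z/k up to an integral vector only costs
    enlarging the cone by the first orthant, which stays compatible. *)
Lemma laurentP x : (x \in @is_laurent R n K le) <->
  (forall a, Supp (coefs x) a -> lattice 1 a).
Proof.
split=> [/asboolP/(fractionalP _ _ (ltn0Sn 0))[z [us [_ sub]]] a /sub[]//|x1].
apply/asboolP/fractionalP => //.
have /puiseuxP[k [k0 /(fractionalP _ _ k0)[z [us [cu sub]]]]] := valP x.
pose z' : 'rV[int]_n := \row_j `|z 0 j|.
exists z', (us ++ unit_vectors n); split=> [|a xa].
  exact: compatible_cat cu (@compatible_unit_vectors _ _ le).
split; first exact: x1.
have [_ ca] := sub _ xa.
rewrite -[a + _](subrKC (a + k%:R^-1 *: map_mx intr z)) to_realD.
apply: cone_cat => //; apply/cone_unit_vectors => j.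
rewrite to_realE ler0q opprD addrACA subrr add0r.
rewrite !mxE invr1 mul1r subr_ge0 intr_norm.
apply: le_trans (_ : k%:R^-1 * `|(z 0 j)%:~R| <= _).
  by rewrite ler_wpM2l ?ler_norm ?invr_ge0.
by rewrite ler_piMl// invf_le1 ?ltr0n// ler1n.
Qed.

Lemma twist_laurent c (x : laurent K le) : twist c (val x) = val x.
Proof.
apply/val_inj/funext => a; rewrite /= /twist_series.
have [->|xa] := eqVneq (coefs (val x) a) 0; first by rewrite mulr0.
by rewrite char_int ?mul1r//; exact: (laurentP _).1 (valP x) a xa.
Qed.

Lemma map_twist_laurent c (h : {poly laurent K le}) :
  map_poly (twist c) (map_poly val h) = map_poly val h.
Proof.
by rewrite -map_poly_comp; apply: eq_map_poly => x /=; exact: twist_laurent.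
Qed.

(** The same [h] gives the same value at [x] and at its conjugate, since
    [h(twist c x) = twist c (h(x))] has the support of [h(x)]. *)
Lemma value_set_twist (A : {pred laurent K le}) c x :
  value_set A x `<=` value_set A (twist c x).
Proof.
move=> _ [h [hA hx] <-]; exists h; last first.
  by rewrite -{1}(map_twist_laurent c) horner_map nu_twist.
split=> // /factor_theorem/rootP.
rewrite -(map_twist_laurent c) horner_map => /eqP.
rewrite raddf_eq0; last exact: twist_inj.
by move=> /factor_theorem.
Qed.

End Twist.

Lemma laurent_fixed (R : realType) (n : nat) (K : closedFieldType)
    (le : additive_order R n) (x : puiseux K le) : [pchar K] =i pred0 ->
  (forall c, twist c x = x) -> x \in @is_laurent R n K le.
Proof.
move=> charK xfix; apply/laurentP => a xa.
apply: (lattice_separation charK) => c.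
apply: (mulIf xa); rewrite mul1r.
exact: (congr1 (fun y : puiseux K le => coefs y a) (xfix c)).
Qed.

(** * Conjugacy of the roots *)

(** A duplicate-free list of elements of [O] of maximal length is exhaustive;
    its length is bounded by the degree of [p]. *)
Lemma enum_roots (D : idomainType) (p : {poly D}) (O : D -> Prop) : p != 0 ->
  (forall x, O x -> root p x) ->
  exists2 rs : seq D, uniq rs & forall x, x \in rs <-> O x.
Proof.
move=> p0 Op.
pose sz m := `[< exists rs : seq D,
  [/\ uniq rs, forall x, x \in rs -> O x & size rs = m] >].
have sz0 : exists m, sz m by exists 0%N; apply/asboolP; exists [::].
have szp m : sz m -> (m <= size p)%N.
  move=> /asboolP[rs [urs rsO <-]]; apply/ltnW/max_poly_roots => //.
  by apply/allP => x /rsO/Op.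
case: (ex_maxnP sz0 szp) => m /asboolP[rs [urs rsO <-]] rsmax.
exists rs => // x; split=> [|Ox]; first exact: rsO.
apply: contrapT => /negP xrs.
suff /rsmax : sz (size rs).+1 by rewrite ltnn.
apply/asboolP; exists (x :: rs); split => //=; first by rewrite xrs.
by move=> y; rewrite inE => /orP[/eqP->|/rsO].
Qed.

(** The orbit polynomial [g] of [xi] is monic over K((X)) and divides [f], so
    by irreducibility it is [f] up to a unit. *)
Lemma conjugate_roots (R : realType) (n : nat) (K : closedFieldType)
    (le : additive_order R n) (f : {poly laurent K le}) (xi xi' : puiseux K le) :
  [pchar K] =i pred0 -> irreducible_elt f ->
  root (map_poly val f) xi -> root (map_poly val f) xi' ->
  exists c, xi' = twist c xi.
Proof.
move=> charK [f0 _ firr] fxi fxi'.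
have v_inj : injective (map_poly (val : laurent K le -> puiseux K le)).
  by apply: map_inj_poly (rmorph0 _); exact: val_inj.
have vf0 : map_poly val f != 0.
  by apply: contra_neq f0 => vf0; apply: v_inj; rewrite vf0 rmorph0.
have rtw c : root (map_poly val f) (twist c xi).
  by rewrite -(map_twist_laurent c); exact: rmorph_root.
have [|rs urs rsE] := enum_roots (O := fun x => exists c, x = twist c xi) vf0.
  by move=> _ [c ->]; exact: rtw.
pose g := \prod_(x <- rs) ('X - x%:P).
(* A character permutes the finite orbit, so it fixes the orbit polynomial. *)
have gfix c : map_poly (twist c) g = g.
  rewrite /g (map_prod_XsubC _ rs xpredT id).
  rewrite -(big_map (twist c) xpredT (fun x => 'X - x%:P)); apply: perm_big.
  have utw : uniq (map (twist c) rs).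
    by rewrite map_inj_uniq//; exact: twist_inj.
  have sub : {subset map (twist c) rs <= rs}.
    move=> _ /mapP[x /rsE[d ->] ->]; apply/rsE.
    by exists (char_mul c d); rewrite twistM.
  apply: uniq_perm => //.
  by have [] := uniq_min_size utw sub; rewrite ?size_map.
(* The default value 0 of insubd is never taken on the coefficients of g. *)
pose gL : {poly laurent K le} := map_poly (insubd 0) g.
have gLE : map_poly val gL = g.
  apply/polyP => i; rewrite coef_map /= coef_map_id0; last first.
    by apply/val_inj; rewrite val_insubd rpred0.
  rewrite insubdK//; apply: laurent_fixed charK _ => c.
  by rewrite -{2}(gfix c) coef_map.
have gm : g \is monic by exact: monic_prod_XsubC.
have gLm : gL \is monic.
  rewrite monicE; apply/eqP/val_inj; rewrite /= -lead_coef_map_inj ?gLE//.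
    by rewrite (monicP gm).
  exact: val_inj.
have szg : size gL = (size rs).+1.
  by rewrite -(size_map_inj_poly val_inj (rmorph0 _)) gLE size_prod_XsubC.
have := Pdiv.RingMonic.rdivp_eq gLm f.
set q := Pdiv.CommonRing.rdivp f gL; set r := Pdiv.CommonRing.rmodp f gL => fE.
(* The remainder vanishes on the orbit, so it has too many roots. *)
have r0 : r = 0.
  apply: v_inj; rewrite rmorph0; apply: contrapT => /eqP vr0.
  have : all (root (map_poly val r)) rs.
    apply/allP => x xrs; have [c xE] := (rsE x).1 xrs.
    have := rtw c; rewrite fE rmorphD rmorphM /= gLE /root hornerD hornerM -xE.
    have /rootP-> : root g x by rewrite root_prod_XsubC.
    by rewrite mulr0 add0r.
  move=> /(max_poly_roots vr0)/(_ urs).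
  rewrite size_map_inj_poly ?rmorph0//; last exact: val_inj.
  by rewrite ltnNge -ltnS -szg Pdiv.Ring.ltn_rmodp monic_neq0.
move: fE; rewrite r0 addr0 => fE; apply/rsE.
have [|] := firr _ _ fE; rewrite poly_unitE => /andP[/eqP sz1 _].
  have /size_poly1P[u u0 qE] : size q == 1%N by rewrite sz1.
  move: fxi'; rewrite fE qE rmorphM /= gLE (map_polyC val) rootM rootC.
  rewrite root_prod_XsubC => /orP[/eqP uv0|//].
  by case/eqP: u0; apply/val_inj.
(* g has the root xi, so it is not constant. *)
have : xi \in rs by apply/rsE; exists (char1 n K); rewrite twist1.
by move: sz1; rewrite szg => -[/size0nil->].
Qed.

Theorem corollary8 (R : realType) (K : closedFieldType)
    (charK : [pchar K] =i pred0) (n : nat) (n_gt0 : (0 < n)%N)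
    (le : additive_order R n)
    (f : {poly laurent K le}) (A : {pred laurent K le})
    (xi xi' : puiseux K le) :
  f \is a polyOver power_series -> f \is monic ->
  GRing.subring_closed A ->
  root (map_poly val f) xi -> root (map_poly val f) xi' ->
  irreducible_elt f ->
  value_set A xi = value_set A xi'.
Proof.
move=> _ _ _ fxi fxi' firr; apply/seteqP; split.
  by have [c ->] := conjugate_roots charK firr fxi fxi'; exact: value_set_twist.
by have [c ->] := conjugate_roots charK firr fxi' fxi; exact: value_set_twist.
Qed.
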